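(* Let $\ell$ be the rate of escape w.r.t. the length function $l$, i.e. the almost sure constant limit $\ell=\lim_{n\to\infty}l(X_n)/n$. Then $\ell$ is non-negative and it is the rate of escape w.r.t. the Greenian metric $d_{\mathrm{Green}}(x,y):=-\log F(x,y|1)$; that is, almost surely $$\ell=\lim_{n\to\infty}-\frac1n\log F(o,X_n|1)\ge0.$$
   Context: Free product. Let $r\ge 2$, $\mathcal I=\{1,\dots,r\}$. For $i\in\mathcal I$ let $V_i$ be a finite or countable set with distinguished root $o_i\in V_i$ (the $V_i$ pairwise disjoint) and let $P_i=(p_i(x,y))_{x,y\in V_i}$ be a stochastic transition matrix, with $n$-step probabilities $p_i^{(n)}(x,y)$. The case $r=2=|V_1|=|V_2|$ is excluded. Standing assumptions: for every $x\in V_i$ there is $n\in\mathbb N$ with $p_i^{(n)}(o_i,x)>0$; $p_i(x,x)=0$ for all $x\in V_i$; uniform irreducibility: there are $\varepsilon_0^{(i)}>0$, $K_i\in\mathbb N$ such that for all $x,y\in V_i$ with $p_i(x,y)>0$ one has $p_i^{(k)}(x,y)\ge\varepsilon_0^{(i)}$ for some $k\le K_i$. Put $V_i^\times=V_i\setminus\{o_i\}$, $V_\ast^\times=\bigcup_i V_i^\times$. The free product $V=V_1\ast\dots\ast V_r$ is the set of all finite words $x_1\dots x_n$ with letters in $V_\ast^\times$, no two consecutive letters from the same $V_i$, together with the empty word $o$. Each $o_i$ is identified with $o$, so $V_i\subseteq V$, and $xo_i:=x$. The type of $u=u_1\dots u_m\in V$ is $\tau(u)=i$ if $u_m\in V_i^\times$;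 $\tau(o)=0$. Random walk. For $x\in V$ with $\tau(x)\ne i$ and $v,w\in V_i$ put $\bar p_i(xv,xw)=p_i(v,w)$, and $\bar p_i=0$ otherwise. Fix $\alpha_1,\dots,\alpha_r>0$ with $\sum_i\alpha_i=1$ and let $P=\sum_i\alpha_i\bar P_i$, with $n$-step probabilities $p^{(n)}(x,y)$. $(X_n)_{n\ge0}$ is the Markov chain on $V$ with $X_0=o$ and transition matrix $P$. Standing assumption: the radius of convergence $R$ of the Green functions $G(x,y|z)=\sum_{n\ge0}p^{(n)}(x,y)z^n$ (the infimum over $x,y\in V$ of the radii of convergence) satisfies $R>1$. Generating functions. $F(x,y|z)=\sum_{n\ge0}\mathbb P[X_n=y,\ X_m\ne y\ \forall m\le n-1\mid X_0=x]z^n$ and $L(x,y|z)=\sum_{n\ge0}\mathbb P[X_n=y,\ X_m\ne x\ \forall 1\le m\le n\mid X_0=x]z^n$, for the chain governed by $P$. The length function is $l(x):=-\log L(o,x|1)$, $x\in V$ (it may take negative values and satisfies $l(v_1\dots v_n)=\sum_jl(v_j)$). The almost sure limit $\ell=\lim_n l(X_n)/n$ exists and is a real constant. *)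

(* Defs.v *)
From HB Require Import structures.
From mathcomp Require Import all_boot all_order all_algebra.
From mathcomp Require Import all_classical all_reals all_analysis.

Set Implicit Arguments.
Unset Strict Implicit.
Unset Printing Implicit Defensive.

Import Order.TTheory GRing.Theory Num.Theory.
Import numFieldNormedType.Exports.

Local Open Scope classical_set_scope.
Local Open Scope ring_scope.
Local Open Scope ereal_scope.

Section Kernels.
Context {R : realType} {T : countType}.
Implicit Types (q : T -> T -> R) (x y : T) (n : nat) (z : R).

Definition stochastic q : Prop :=
  (forall x y, (0 <= q x y)%R) /\
  (forall x, \esum_(y in [set: T]) (q x y)%:E = 1).

Fixpoint nstep q n x y : \bar R :=
  if n is m.+1 then \esum_(w in [set: T]) ((q x w)%:E * nstep q m w y)
  else (x == y)%:R%:E.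

Definition uniformly_irreducible q : Prop :=
  exists (eps : R) (K : nat), (0 < eps)%R /\
    forall x y, (0 < q x y)%R ->
      exists k : nat, (k <= K)%N /\ eps%:E <= nstep q k x y.

Definition genfun (a : nat -> \bar R) z : \bar R :=
  \sum_(0 <= n <oo) (a n * (z ^+ n)%:E).

(* Only used for nonnegative coefficients, for which the radius of convergence
   is the supremum of the z >= 0 at which the series has a finite sum. *)
Definition conv_radius (a : nat -> \bar R) : \bar R :=
  ereal_sup [set z%:E | z in [set z : R | (0 <= z)%R /\ genfun a z < +oo]].

(* The Green function is G(x,y|z) = genfun (fun n => nstep q n x y) z. *)
Definition green_radius q : \bar R :=
  ereal_inf [set conv_radius (fun n => nstep q n xy.1 xy.2)
            | xy in [set: T * T]].

(* The probability, for the chain with transition matrix q started at x, that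
   the trajectory (X_0, ..., X_n) belongs to E. *)
Definition path_prob q n x (E : set {ffun 'I_n.+1 -> T}) : \bar R :=
  \esum_(w in [set w : {ffun 'I_n.+1 -> T} | w ord0 = x /\ E w])
    (\prod_(k < n) q (w (widen_ord (leqnSn n) k)) (w (lift ord0 k)))%:E.

Definition Fgen q x y z : \bar R :=
  genfun (fun n => path_prob q x [set w : {ffun 'I_n.+1 -> T} |
    w ord_max = y /\ forall m : 'I_n.+1, (m < n)%N -> w m <> y]) z.

Definition Lgen q x y z : \bar R :=
  genfun (fun n => path_prob q x [set w : {ffun 'I_n.+1 -> T} |
    w ord_max = y /\ forall m : 'I_n.+1, (0 < m)%N -> w m <> x]) z.

Definition length_fun q x0 x : \bar R := - lne (Lgen q x0 x 1%R).

Definition dGreen q x y : \bar R := - lne (Fgen q x y 1%R).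

(* The Markov property is stated with the conditioning multiplied out, so that
   it also makes sense for trajectories of probability zero. *)
Definition markov_chain (d : measure_display) (Omega : measurableType d)
    (Pr : probability Omega R) q x0 (X : nat -> Omega -> T) : Prop :=
  [/\ forall n x, measurable (X n @^-1` [set x]),
      Pr (X 0%N @^-1` [set x0]) = 1 &
      forall n (t : nat -> T),
        Pr (\bigcap_(k in `I_n.+2) (X k @^-1` [set t k])) =
        Pr (\bigcap_(k in `I_n.+1) (X k @^-1` [set t k])) *
          (q (t n) (t n.+1))%:E].

End Kernels.

Section FreeProduct.
Context {r : nat} (V : 'I_r -> countType) (o : forall i, V i).

Definition letter : Type := {i : 'I_r & V i}.

Definition reduced (w : seq letter) : bool :=
  all (fun a : letter => tagged a != o (tag a)) w &&
  sorted (fun a b : letter => tag a != tag b) w.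

Definition freeprod : Type := {w : seq letter | reduced w}.

Definition eword : freeprod := exist _ [::] isT.

(* None stands for the type 0 of the empty word. *)
Definition wtype (w : seq letter) : option 'I_r :=
  omap tag (ohead (rev w)).

(* The word xv for v in V_i, with the convention x o_i = x. *)
Definition wext (x : seq letter) (i : 'I_r) (v : V i) : seq letter :=
  if v == o i then x else rcons x (Tagged V v).

(* Every word y is uniquely xv with wtype x != Some i and v in V_i:
   x = wstem i y and v = wcoord i y (see wextK, wtype_wstem, wstemK, wcoordK).
   The default letter o_i of [last] covers the empty word. *)
Definition wstem (i : 'I_r) (y : seq letter) : seq letter :=
  if tag (last (Tagged V (o i)) y) == i then take (size y).-1 y else y.

Definition wcoord (i : 'I_r) (y : seq letter) : V i :=
  untag (o i) (fun v : V i => v) (last (Tagged V (o i)) y).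

Context {R : realType} (p : forall i, V i -> V i -> R) (alpha : 'I_r -> R).
Arguments p : clear implicits.

Definition pbar (i : 'I_r) (y z : seq letter) : R :=
  if wstem i y == wstem i z then p i (wcoord i y) (wcoord i z) else 0%R.

Definition freeprod_kernel (y z : freeprod) : R :=
  (\sum_(i < r) alpha i * pbar i (val y) (val z))%R.

Lemma wtype_rcons (x : seq letter) (a : letter) :
  wtype (rcons x a) = Some (tag a).
Proof. by rewrite /wtype rev_rcons. Qed.

Lemma tag_last (i : 'I_r) (x : seq letter) : wtype x != Some i ->
  (tag (last (Tagged V (o i)) x) == i) = (x == [::]).
Proof.
case/lastP: x => [|x a]; first by rewrite /= !eqxx.
rewrite wtype_rcons last_rcons => ai.
by rewrite -size_eq0 size_rcons; apply: contra_neqF ai => /eqP ->.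
Qed.

Lemma wstemK (i : 'I_r) (x : seq letter) (v : V i) : wtype x != Some i ->
  wstem i (wext x v) = x.
Proof.
move=> xi; rewrite /wext; case: eqVneq => [_|_].
  by rewrite /wstem tag_last//; case: eqVneq => [->|].
by rewrite /wstem last_rcons /= eqxx size_rcons /= -cats1 take_size_cat.
Qed.

Lemma wcoordK (i : 'I_r) (x : seq letter) (v : V i) : wtype x != Some i ->
  wcoord i (wext x v) = v.
Proof.
move=> xi; rewrite /wext; case: eqVneq => [->|_].
  case/lastP: x xi => [|x a] xi; first by rewrite /wcoord /= untagE.
  rewrite /wcoord untag_dflt // last_rcons.
  by move: xi; rewrite wtype_rcons; apply: contra_neq => ->.
by rewrite /wcoord last_rcons untagE.
Qed.

Lemma wextK (i : 'I_r) (y : seq letter) : reduced y ->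
  wext (wstem i y) (wcoord i y) = y.
Proof.
case/lastP: y => [|y [j v]]; first by rewrite /wext /wcoord /wstem /= untagE !eqxx.
rewrite /reduced all_rcons /= => /andP[/andP[vo _] _].
rewrite /wext /wcoord /wstem last_rcons /=.
have [ji|ji] := eqVneq j i.
  subst j; rewrite untagE (negbTE vo) size_rcons /=.
  by rewrite -[in take _ _]cats1 take_size_cat.
by rewrite untag_dflt ?eqxx// eq_sym.
Qed.

Lemma wtype_wstem (i : 'I_r) (y : seq letter) : reduced y ->
  wtype (wstem i y) != Some i.
Proof.
case/lastP: y => [|y a]; first by rewrite /wstem /= eqxx.
rewrite /reduced /wstem last_rcons => /andP[_ sa].
have [ai|ai] := eqVneq (tag a) i; last by rewrite wtype_rcons.
rewrite size_rcons /= -cats1 take_size_cat//.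
case/lastP: y sa => [//|y b]; rewrite wtype_rcons.
rewrite -!cats1 -catA /= => /cat_sorted2[_] /=; rewrite andbT ai.
by apply: contra => /eqP[->].
Qed.

Lemma pbar_wext (i : 'I_r) (x : seq letter) (v w : V i) : wtype x != Some i ->
  pbar i (wext x v) (wext x w) = p i v w.
Proof. by move=> xi; rewrite /pbar !wstemK// eqxx !wcoordK. Qed.

Lemma pbar_eq0 (i : 'I_r) (y z : seq letter) : reduced y -> reduced z ->
  (forall (x : seq letter) (v w : V i), wtype x != Some i ->
     ~ (y = wext x v /\ z = wext x w)) ->
  pbar i y z = 0%R.
Proof.
move=> ry rz yz; rewrite /pbar; case: eqVneq => // e; exfalso.
apply: (yz (wstem i y) (wcoord i y) (wcoord i z)); first exact: wtype_wstem.
by split; [rewrite wextK | rewrite e wextK].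
Qed.

End FreeProduct.

Arguments stochastic {R T} q.
Arguments nstep {R T} q n x y.
Arguments eword {r V o}.
Arguments freeprod_kernel {r V} o {R} p alpha y z.

(* Main.v *)
Require Import Defs.
From HB Require Import structures.
From mathcomp Require Import all_boot all_order all_algebra.
From mathcomp Require Import all_classical all_reals all_analysis.
From mathcomp Require Import lra.

Import Order.TTheory GRing.Theory Num.Theory.
Import numFieldNormedType.Exports.

Local Open Scope classical_set_scope.
Local Open Scope ring_scope.
Local Open Scope ereal_scope.

(* Write G, F, L for the generating functions at z = 1.  Both F(., y) and
   L(x, .) are Green functions of a modified kernel (stopped at y, resp. never
   entering x), and G(x, y) = F(x, y) G(y, y) = G(x, x) L(x, y).  Hence
   - log F(o, x) and - log L(o, x) differ by a bounded amount as soon as the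
   diagonal G(x, x) is bounded, and then they have the same linear rate, which
   is nonnegative because F <= 1.

   The diagonal is bounded because the return probability to x stays away
   from 1.  The function equal to F(w, o) at x w and to 1 off the cone of words
   extending x is superharmonic off x, so it dominates F(., x), and it is
   smaller than 1 at the words x v for some letter v of each V_j other than the
   type of x.  Such letters with F(v, o) < 1 exist for one j by transience,
   and for any other k because from a letter of V_k the walk may escape
   through a copy of V_j. *)

(** One inequality holds on finite subsums for every scalar. The other is the same inequality for
    the scalar [c^-1], once [c = 0] is set apart. *)
Lemma esumZl (R : realType) (I : choiceType) (D : set I) (a : I -> \bar R)
    (c : \bar R) : 0 <= c -> c \is a fin_num -> (forall i, D i -> 0 <= a i) ->
  \esum_(i in D) (c * a i) = c * \esum_(i in D) a i.
Proof.
have le (b : I -> \bar R) (e : \bar R) : 0 <= e -> (forall i, D i -> 0 <= b i) ->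
    \esum_(i in D) (e * b i) <= e * \esum_(i in D) b i.
  move=> e0 b0; apply: ge_ereal_sup => _ [A [finA AD] <-] /=.
  rewrite fsbig_finite//= big_seq -ge0_sume_distrr => [|i].
    apply: lee_wpmul2l => //; rewrite -big_seq -fsbig_finite//.
    by apply: ereal_sup_ubound; exists A.
  by rewrite in_fset_set// => /set_mem/AD/b0.
move=> c0 cfin a0; apply/eqP; rewrite eq_le le//=.
have [->|cn0] := eqVneq c 0.
  by rewrite mul0e; apply: esum_ge0 => i _; rewrite mul0e.
have fc : (0 < fine c)%R by rewrite fine_gt0// lt0e cn0 c0 /= ltey_eq cfin.
rewrite -(fineK cfin).
have -> : \esum_(i in D) a i =
    \esum_(i in D) ((fine c)^-1%:E * ((fine c)%:E * a i)).
  by apply: eq_esum => i _; rewrite muleA -EFinM mulVf ?gt_eqF// mul1e.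
apply: (@le_trans _ _ ((fine c)%:E *
    ((fine c)^-1%:E * \esum_(i in D) ((fine c)%:E * a i)))).
  apply: lee_wpmul2l; first by rewrite lee_fin ltW.
  apply: le => [|i Di]; first by rewrite lee_fin invr_ge0 ltW.
  by rewrite mule_ge0 ?lee_fin ?a0// ltW.
by rewrite muleA -EFinM mulfV ?gt_eqF// mul1e.
Qed.

(** * Kernels as operators and their Green functions *)

Section KernelOperator.
Context {R : realType} {T : countType}.
Implicit Types (k q : T -> T -> R) (f g : T -> \bar R) (u w x y : T).

Definition kop k f u : \bar R := \esum_(w in [set: T]) ((k u w)%:E * f w).

Definition green k x y : \bar R := \sum_(0 <= n <oo) nstep k n x y.

Definition nonneg_kernel k := forall x y, (0 <= k x y)%R.

Section Nonneg.
Context k (k0 : nonneg_kernel k).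

Lemma kop_ge0 f u : (forall w, 0 <= f w) -> 0 <= kop k f u.
Proof. by move=> f0; apply: esum_ge0 => w _; rewrite mule_ge0 ?lee_fin. Qed.

Lemma le_kop f g u : (forall w, f w <= g w) -> kop k f u <= kop k g u.
Proof. by move=> fg; apply: le_esum => w _; rewrite lee_wpmul2l ?lee_fin. Qed.

Lemma kopD f g u : (forall w, 0 <= f w) -> (forall w, 0 <= g w) ->
  kop k (fun w => f w + g w) u = kop k f u + kop k g u.
Proof.
move=> f0 g0; rewrite /kop -esumD => [|w _|w _]; rewrite ?mule_ge0 ?lee_fin//.
by apply: eq_esum => w _; rewrite ge0_muleDr.
Qed.

Lemma kopZr f u (c : \bar R) : 0 <= c -> c \is a fin_num ->
  (forall w, 0 <= f w) -> kop k (fun w => f w * c) u = kop k f u * c.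
Proof.
move=> c0 cfin f0; rewrite /kop muleC -esumZl// => [|w _]; last by rewrite mule_ge0 ?lee_fin.
by apply: eq_esum => w _; rewrite muleA muleC.
Qed.

Lemma nstep_ge0 n x y : 0 <= nstep k n x y.
Proof.
by elim: n x => [|n IH] x /=; [rewrite lee_fin ler0n | apply: kop_ge0].
Qed.

Lemma green_ge0 x y : 0 <= green k x y.
Proof. by apply: nneseries_ge0 => n _ _; apply: nstep_ge0. Qed.

(** First-step decomposition: split off time 0, then exchange the sums over the time and over the
    first state, which nonnegativity permits. *)
Lemma greenE x y :
  green k x y = (x == y)%:R%:E + kop k (green k ^~ y) x.
Proof.
rewrite /green nneseries_recl => [|n _|//]; last exact: nstep_ge0.
congr (_ + _).
rewrite -(@nneseries_addn _ (fun n => nstep k n x y) 1%N); last first.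
  by move=> n; apply: nstep_ge0.
rewrite nneseries_esumT => [|n]; last exact: nstep_ge0.
rewrite [LHS](_ : _ = \esum_(n in [set: nat])
    \esum_(w in [set: T]) ((k x w)%:E * nstep k n w y)); last first.
  by apply: eq_esum => n _; rewrite addn1.
rewrite esum_esum => [|n w _ _]; last by rewrite mule_ge0 ?nstep_ge0 ?lee_fin.
rewrite (@reindex_esum _ _ _ ([set: T] `*`` fun=> [set: nat]) _
  (fun wn => (wn.2, wn.1))); last first.
  split=> [[w n]//|[w n] [w' n'] _ _ [-> ->]//|[n w] _]; by exists (w, n).
rewrite -(@esum_esum _ _ _ _ (fun=> [set: nat])
  (fun w n => (k x w)%:E * nstep k n w y)) => [|w n _ _]; last first.
  by rewrite mule_ge0 ?nstep_ge0 ?lee_fin.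
apply: eq_esum => w _; rewrite esumZl ?lee_fin// => [|n _]; last exact: nstep_ge0.
by rewrite -nneseries_esumT// => n; apply: nstep_ge0.
Qed.

(** Minimality principle behind all later upper bounds. By induction on [N], the sum of the first
    [N] terms of the series stays below [g], since each partial sum arises from the previous one by
    the recursion that [g] dominates. *)
Lemma green_min g y : (forall u, 0 <= g u) ->
  (forall u, (u == y)%:R%:E + kop k g u <= g u) -> forall u, green k u y <= g u.
Proof.
move=> g0 gP u; apply: lime_le.
  by apply: is_cvg_nneseries => n _ _; apply: nstep_ge0.
apply: nearW => N; elim: N u => [|N IH] u; first by rewrite big_geq.
rewrite big_nat_recl//=; apply: le_trans (gP u); apply: leeD2l.
rewrite -esum_sum => [|w n _ _]; last by rewrite mule_ge0 ?nstep_ge0 ?lee_fin.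
apply: le_esum => w _; rewrite -ge0_sume_distrr => [|n _]; last exact: nstep_ge0.
by rewrite lee_wpmul2l ?lee_fin.
Qed.

End Nonneg.
End KernelOperator.

(** * Path sums expressed through modified kernels *)

Section Paths.
Context {R : realType} {T : countType}.
Implicit Types (k q : T -> T -> R) (u w x y : T).

Definition path_weight k {n} (t : {ffun 'I_n.+1 -> T}) : R :=
  (\prod_(i < n) k (t (widen_ord (leqnSn n) i)) (t (lift ord0 i)))%R.

Definition path_cons x {n} (t : {ffun 'I_n.+1 -> T}) : {ffun 'I_n.+2 -> T} :=
  [ffun i => if unlift ord0 i is Some j then t j else x].

Lemma path_cons0 x n (t : {ffun 'I_n.+1 -> T}) : path_cons x t ord0 = x.
Proof. by rewrite ffunE unlift_none. Qed.

Lemma path_cons_lift x n (t : {ffun 'I_n.+1 -> T}) j :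
  path_cons x t (lift ord0 j) = t j.
Proof. by rewrite ffunE liftK. Qed.

Lemma path_weight_cons k x n (t : {ffun 'I_n.+1 -> T}) :
  path_weight k (path_cons x t) = (k x (t ord0) * path_weight k t)%R.
Proof.
rewrite /path_weight big_ord_recl path_cons_lift; congr (_ * _)%R.
  by rewrite [widen_ord _ _](_ : _ = ord0) ?path_cons0//; apply: val_inj.
apply: eq_bigr => i _; rewrite path_cons_lift.
rewrite [widen_ord _ _](_ : _ = lift ord0 (widen_ord (leqnSn n) i)).
  by rewrite path_cons_lift.
exact: val_inj.
Qed.

Lemma path_weight_ge0 k n (t : {ffun 'I_n.+1 -> T}) : nonneg_kernel k ->
  (0 <= path_weight k t)%R.
Proof. by move=> k0; apply: prodr_ge0 => i _; apply: k0. Qed.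

(** Induction on the length: a trajectory from [x] corresponds to the pair of its second state and
    its tail, and its weight factors accordingly. *)
Lemma path_prob_nstep k n x y : nonneg_kernel k ->
  path_prob k x [set t : {ffun 'I_n.+1 -> T} | t ord_max = y] = nstep k n x y.
Proof.
move=> k0; elim: n x => [|n IH] x.
  rewrite /path_prob /=; have [<-{y}|xy] := eqVneq x y.
    rewrite [X in esum X _](_ : _ = [set [ffun=> x]]).
      by rewrite esum_set1 ?big_ord0 ?lee_fin.
    apply/seteqP; split=> [t [t0 _]|_ ->] /=; last by rewrite !ffunE.
    by apply/ffunP => i; rewrite ffunE -t0 (ord1 i).
  rewrite esum1// => t [t0 ty]; case/eqP: xy; rewrite -t0 -ty.
  by congr (t _); apply: val_inj.
rewrite /= /path_prob.
pose J v := [set t : {ffun 'I_n.+1 -> T} | t ord0 = v /\ t ord_max = y].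
rewrite (@reindex_esum _ _ _ ([set: T] `*`` J) _
    (fun vt => path_cons x vt.2)); last first.
  have omax : ord_max = lift ord0 (ord_max : 'I_n.+1) by exact: val_inj.
  split.
  - by move=> [v t] [_ [/= t0 ty]]; rewrite path_cons0 omax path_cons_lift.
  - move=> [v t] [v' t'] /set_mem[_ [/= t0 _]] /set_mem[_ [/= t0' _]] e.
    have tt : t = t'.
      by apply/ffunP => i; rewrite -(path_cons_lift x _ t) e path_cons_lift.
    by rewrite tt -t0 -t0' tt.
  - move=> t [t0 ty]; exists (t (lift ord0 ord0), [ffun j => t (lift ord0 j)]).
      by split => //=; rewrite /J /= !ffunE -omax.
    apply/ffunP => i /=; rewrite ffunE; case: unliftP => [j ->|->//].
    by rewrite ffunE.
rewrite -(@esum_esum _ _ _ _ J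
    (fun _ t => (path_weight k (path_cons x t))%:E)); last first.
  by move=> v t _ _; rewrite lee_fin path_weight_ge0.
apply: eq_esum => v _; rewrite -IH /path_prob -esumZl ?lee_fin//; last first.
  by move=> t _; rewrite lee_fin; apply: path_weight_ge0.
by apply: eq_esum => t [t0 _]; rewrite path_weight_cons t0 EFinM.
Qed.

(** The row of [y] is zero rather than a Dirac mass, so a path has no weight after reaching [y] and
    only first visits are counted. *)
Definition stopped q y u w : R := if u == y then 0%R else q u w.

(** Only entering [x] is forbidden; a path may still start there. *)
Definition taboo q x u w : R := if w == x then 0%R else q u w.

Lemma stopped_ge0 q y : nonneg_kernel q -> nonneg_kernel (stopped q y).
Proof. by move=> q0 u w; rewrite /stopped; case: ifP. Qed.

Lemma taboo_ge0 q x : nonneg_kernel q -> nonneg_kernel (taboo q x).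
Proof. by move=> q0 u w; rewrite /taboo; case: ifP. Qed.

(** Trades a constraint [E] on trajectories for a change of kernel, which makes [F] and [L]
    accessible to [green_min]. *)
Lemma path_prob_kill q k n x (A E : set {ffun 'I_n.+1 -> T}) :
  (forall t, E t -> path_weight k t = path_weight q t) ->
  (forall t, ~ E t -> path_weight k t = 0%R) ->
  path_prob q x [set t | A t /\ E t] = path_prob k x A.
Proof.
move=> kE kN; rewrite /path_prob esum_mkcond [RHS]esum_mkcond.
apply: eq_esum => t _; rewrite -!/(path_weight _ t).
have [Et|nEt] := pselect (E t).
  rewrite kE//; congr (if _ then _ else _).
  by apply/asbool_equiv_eq => /=; tauto.
rewrite kN// [t \in _](_ : _ = false) ?if_same//.
by apply/negbTE/negP => /set_mem[_ []].
Qed.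

Lemma Fgen_green q x y : nonneg_kernel q ->
  Fgen q x y 1%R = green (stopped q y) x y.
Proof.
move=> q0; apply: eq_eseriesr => n _; rewrite expr1n mule1.
rewrite -path_prob_nstep; last exact: stopped_ge0.
apply: path_prob_kill => t.
  move=> Et; apply: eq_bigr => i _; rewrite /stopped ifN//.
  by apply/eqP; apply: Et => /=.
move=> /existsNP[m /not_implyP[mn /contrapT tm]]; apply/eqP/prodf_eq0.
exists (Ordinal mn) => //; rewrite /stopped.
by rewrite [widen_ord _ _](_ : _ = m) ?tm ?eqxx//; apply: val_inj.
Qed.

Lemma Lgen_green q x y : nonneg_kernel q ->
  Lgen q x y 1%R = green (taboo q x) x y.
Proof.
move=> q0; apply: eq_eseriesr => n _; rewrite expr1n mule1.
rewrite -path_prob_nstep; last exact: taboo_ge0.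
apply: path_prob_kill => t.
  move=> Et; apply: eq_bigr => i _; rewrite /taboo ifN//.
  by apply/eqP; apply: Et => /=.
move=> /existsNP[m /not_implyP[m0 /contrapT tm]]; apply/eqP/prodf_eq0.
case: (unliftP ord0 m) m0 tm => [j ->|->//] _ tm.
by exists j => //; rewrite /taboo tm eqxx.
Qed.

End Paths.

(** * First-passage and last-exit comparisons *)

Section Potential.
Context {R : realType} {T : countType}.
Context (q : T -> T -> R) (q0 : nonneg_kernel q).
Implicit Types (f g : T -> \bar R) (u w x y : T).

Local Notation G := (green q).
Local Notation F u y := (green (stopped q y) u y).
Local Notation L x y := (green (taboo q x) x y).

Definition substochastic := forall u, kop q (fun=> 1) u <= 1.

Lemma kop_stopped_eq f y : kop (stopped q y) f y = 0.
Proof. by apply: esum1 => w _; rewrite /stopped eqxx mul0e. Qed.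

Lemma kop_stopped_neq f y u : u != y -> kop (stopped q y) f u = kop q f u.
Proof. by move=> uy; apply: eq_esum => w _; rewrite /stopped (negbTE uy). Qed.

Lemma esum_single x (a : \bar R) : 0 <= a ->
  \esum_(w in [set: T]) (if w == x then a else 0) = a.
Proof.
move=> a0; rewrite -[RHS](@esum_set1 _ _ x (fun=> a))// [RHS]esum_mkcond.
apply: eq_esum => w _; congr (if _ then _ else _).
by apply/eqP/idP => [->|/set_mem//]; rewrite inE.
Qed.

Lemma kop_taboo f x u : (forall w, 0 <= f w) ->
  kop q f u = kop (taboo q x) f u + (q u x)%:E * f x.
Proof.
move=> f0; have c0 : 0 <= (q u x)%:E * f x by rewrite mule_ge0 ?lee_fin.
rewrite -(esum_single x _ c0) /kop -esumD => [|w _|w _]; last 2 first.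
- by rewrite mule_ge0 ?lee_fin// taboo_ge0.
- by case: ifP.
apply: eq_esum => w _; rewrite /taboo; case: eqVneq => [->|_].
  by rewrite mul0e add0e.
by rewrite adde0.
Qed.

(** This is [green_min] for the stopped kernel, whose operator vanishes at [y]: there only the bound
    by 1 remains to be asked. *)
Lemma hit_min g y : (forall u, 0 <= g u) -> 1 <= g y ->
  (forall u, u != y -> kop q g u <= g u) -> forall u, F u y <= g u.
Proof.
move=> g0 gy gP; apply: green_min => //; first exact: stopped_ge0.
move=> u; have [->|uy] := eqVneq u y; first by rewrite kop_stopped_eq adde0.
by rewrite add0e kop_stopped_neq ?gP.
Qed.

Lemma hit_ge0 u y : 0 <= F u y.
Proof. by apply: green_ge0; apply: stopped_ge0. Qed.

Lemma hit_refl y : F y y = 1.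
Proof. by rewrite greenE ?kop_stopped_eq ?eqxx ?adde0//; apply: stopped_ge0. Qed.

Lemma hit_step u y : u != y -> F u y = kop q (fun w => F w y) u.
Proof.
move=> uy; rewrite greenE; last exact: stopped_ge0.
by rewrite (negbTE uy) add0e kop_stopped_neq.
Qed.

Lemma hit_le1 (qs : substochastic) u y : F u y <= 1.
Proof. by apply: (@hit_min (fun=> 1)). Qed.

Lemma green_ge1 y : 1 <= G y y.
Proof. by rewrite greenE// eqxx leeDl// kop_ge0// => w; apply: green_ge0. Qed.

Lemma kop_green_le u y : kop q (G ^~ y) u <= G u y.
Proof. by rewrite [leRHS]greenE// leeDr// lee_fin ler0n. Qed.

(** The quotient of [G u y] by [G y y] is superharmonic in [u] and equals 1 at [y], so [hit_min]
    applies to it. *)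
Lemma hit_mul_le u y : G y y \is a fin_num -> F u y * G y y <= G u y.
Proof.
move=> Gfin; have G1 := green_ge1 y.
have Gp : (0 < fine (G y y))%R.
  by rewrite -lte_fin fineK// (lt_le_trans _ G1).
pose c := ((fine (G y y))^-1)%:E : \bar R.
have c0 : 0 <= c by rewrite lee_fin invr_ge0 ltW.
have cG : c * G y y = 1.
  by rewrite /c -{2}(fineK Gfin) -EFinM mulVf// gt_eqF.
have -> : G u y = G u y * c * G y y by rewrite -muleA cG mule1.
apply: lee_wpmul2r; first exact: green_ge0.
apply: (@hit_min (fun u => G u y * c)) => [w||w wy].
- by rewrite mule_ge0 ?green_ge0.
- by rewrite muleC cG.
- rewrite kopZr// => [|v]; last exact: green_ge0.
  by rewrite lee_wpmul2r ?kop_green_le.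
Qed.

(** Minimality of [G] against [F u y * G y y]. Off [y] the required relation is the harmonicity of
    [F]; at [y] it follows from [hit_mul_le]. *)
Lemma green_hit_le u y : G y y \is a fin_num -> G u y <= F u y * G y y.
Proof.
move=> Gfin; have Gge := green_ge0 q q0 y y.
move: u; apply: green_min => // [u|u]; first by rewrite mule_ge0 ?hit_ge0.
have [->|uy] := eqVneq u y.
  rewrite hit_refl mul1e [leRHS]greenE// eqxx leeD2l// le_kop// => w.
  exact: hit_mul_le.
by rewrite add0e kopZr// ?hit_step// => w; apply: hit_ge0.
Qed.

Lemma green_return y : G y y \is a fin_num ->
  G y y = 1 + kop q (fun w => F w y) y * G y y.
Proof.
move=> Gfin; have Gge := green_ge0 q q0 y y.
rewrite {1}greenE// eqxx; congr (_ + _); rewrite -kopZr//; last first.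
  by move=> w; apply: hit_ge0.
apply: eq_esum => w _; congr (_ * _).
by apply/eqP; rewrite eq_le green_hit_le ?hit_mul_le.
Qed.

Lemma taboo_le_green x u y : green (taboo q x) u y <= G u y.
Proof.
move: u; apply: green_min => [|u|u]; first exact: taboo_ge0.
  exact: green_ge0.
rewrite [leRHS]greenE// leeD2l// (kop_taboo _ x) ?leeDl// => [|w].
  by rewrite mule_ge0 ?lee_fin ?green_ge0.
exact: green_ge0.
Qed.

(** Visits to [y] are sorted by the last preceding visit to [x]; only the upper bound is
    established, by minimality of [G]. *)
Lemma green_last_exit_le x y : L x y \is a fin_num -> G x y <= G x x * L x y.
Proof.
move=> Lfin; have t0 := taboo_ge0 q x q0.
have L0 : 0 <= L x y by apply: green_ge0.
have K0 u : 0 <= kop q (G ^~ x) u by apply: kop_ge0 => // w; apply: green_ge0.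
(* The factor [kop q (G ^~ x) u] counts visits to [x] at positive times. At [u = x] the first
   summand accounts for the visit at time 0, so [g x] is [G x x * L x y]. *)
pose g u := green (taboo q x) u y + kop q (G ^~ x) u * L x y.
suff gP u : G u y <= g u.
  apply: le_trans (gP x) _; rewrite [in leRHS]greenE// eqxx.
  by rewrite ge0_muleDl// mul1e.
move: u; apply: green_min => // u.
  by rewrite adde_ge0 ?mule_ge0 ?green_ge0.
rewrite /g kopD => [|//|w|w]; last 2 first.
- exact: green_ge0.
- by rewrite mule_ge0.
rewrite kopZr// (kop_taboo _ x) => [|w]; last exact: green_ge0.
rewrite [in leRHS](greenE _ t0) -!addeA !leeD2l//.
rewrite -ge0_muleDl ?lee_fin//; last exact: kop_ge0.
apply: lee_wpmul2r => //.
(* What remains is the recursion [greenE] for [G ^~ x] with [kop q] applied once more. *)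
rewrite [leRHS](_ : _ = kop q (fun w => (w == x)%:R%:E + kop q (G ^~ x) w) u).
  rewrite kopD//.
  rewrite leeD2r// (kop_taboo _ x) => [|w]; last by rewrite lee_fin ler0n.
  by rewrite eqxx mule1 leeDr// kop_ge0.
by apply: eq_esum => w _; rewrite {1}greenE.
Qed.

(** Both quantities are compared with [G x y], using [G y y >= 1] for the first bound and
    [L x y <= G x y] for the second. *)
Lemma hit_taboo_equiv x y (M : R) : G x x <= M%:E -> G y y <= M%:E ->
  G x y \is a fin_num ->
  F x y <= L x y * M%:E /\ L x y <= F x y * M%:E.
Proof.
move=> Gx Gy Gxy.
have fin u : G u u <= M%:E -> G u u \is a fin_num.
  by move=> le; rewrite ge0_fin_numE ?green_ge0// (le_lt_trans le) ?ltry.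
have L0 : 0 <= L x y by apply: green_ge0 => //; apply: taboo_ge0.
have Lfin : L x y \is a fin_num.
  rewrite ge0_fin_numE// (le_lt_trans (taboo_le_green _ _ _))//.
  by rewrite ltey_eq Gxy.
split.
- apply: (@le_trans _ _ (F x y * G y y)).
    by rewrite lee_pemulr ?hit_ge0 ?green_ge1.
  apply: le_trans (hit_mul_le _ _ (fin _ Gy)) _.
  apply: le_trans (green_last_exit_le _ _ Lfin) _.
  by rewrite muleC lee_wpmul2l.
- apply: le_trans (taboo_le_green _ _ _) _.
  apply: le_trans (green_hit_le _ _ (fin _ Gy)) _.
  by rewrite lee_wpmul2l ?hit_ge0.
Qed.

(** The mass [q x y] carries a value at most [c] instead of 1, so adding back [q x y * (1 - c)]
    keeps the total at most 1. *)
Lemma kop_le_gap f x y (c : R) : substochastic ->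
  (forall w, 0 <= f w <= 1) -> f y <= c%:E ->
  kop q f x <= (1 - q x y * (1 - c))%:E.
Proof.
move=> qs f01 fy.
have f0 w : 0 <= f w by case/andP: (f01 w).
(* For [c > 1] the claimed bound is at least 1 and substochasticity suffices. *)
have [c1|c1] := leP c 1%R; last first.
  apply: (@le_trans _ _ 1); last first.
    by rewrite lee_fin; have := q0 x y; nra.
  by apply: le_trans (qs x); apply: le_kop => // w; case/andP: (f01 w).
have d0 : 0 <= (q x y * (1 - c))%:E by rewrite lee_fin mulr_ge0// subr_ge0.
rewrite EFinB leeBrDr// -(esum_single y _ d0) /kop -esumD => [|w _|w _].
- apply: le_trans (qs x); apply: le_esum => w _; case: eqVneq => [->|_].
    rewrite EFinM -ge0_muleDr ?lee_fin ?subr_ge0// lee_wpmul2l ?lee_fin//.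
    apply: le_trans (leeD2r _ fy) _.
    by rewrite -EFinD lee_fin addrCA subrr addr0.
  by rewrite adde0 lee_wpmul2l ?lee_fin//; case/andP: (f01 w).
- by rewrite mule_ge0 ?lee_fin.
- by case: ifP.
Qed.

(** With [u] the return probability, [G = 1 + u * G] and [u <= 1 - e] give [e * G <= 1]. *)
Lemma green_le_inv y (e : R) : (0 < e)%R -> G y y \is a fin_num ->
  kop q (fun w => F w y) y <= (1 - e)%:E -> G y y <= (e^-1)%:E.
Proof.
move=> e0 Gfin; have := green_return _ Gfin; have := green_ge0 _ q0 y y.
have := @kop_ge0 _ _ _ q0 (fun w => F w y) y (fun w => hit_ge0 w y).
rewrite -(fineK Gfin); move: (fine _) => g.
case: (kop _ _ _) => [u||]//; rewrite !lee_fin => u0 g0.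
rewrite -EFinM -EFinD => -[gE] ue.
by rewrite -[leRHS]mul1r ler_pdivlMr//; nra.
Qed.

End Potential.

(** * Combinatorics of reduced words *)

Section Words.
Context {r : nat} {V : 'I_r -> countType} (o : forall i, V i).
Implicit Types (i j : 'I_r) (x y w : seq (letter V)).

Lemma wstem_cat i x w : w != [::] -> wstem o i (x ++ w) = x ++ wstem o i w.
Proof.
case/lastP: w => // w a _; rewrite /wstem last_cat !last_rcons.
case: ifP => // _; rewrite -rcons_cat !size_rcons /= -!cats1.
by rewrite take_size_cat// take_size_cat.
Qed.

Lemma wcoord_cat i x w : w != [::] -> wcoord o i (x ++ w) = wcoord o i w.
Proof. by case/lastP: w => // w a _; rewrite /wcoord last_cat !last_rcons. Qed.

Lemma prefix_wstem i y : prefix (wstem o i y) y.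
Proof. by rewrite /wstem; case: ifP => _; rewrite ?prefix_take ?prefix_refl. Qed.

(** If the stem removes nothing, either [y] is empty or its last letter has another type; in both
    cases the coordinate is the root. *)
Lemma wcoord_wstem_id i y : wstem o i y = y -> wcoord o i y = o i.
Proof.
case/lastP: y => [|y a]; first by rewrite /wcoord /= untagE.
rewrite /wstem /wcoord last_rcons; case: ifPn => [_|ai _].
  move=> /(congr1 size); rewrite size_take size_rcons ltnSn.
  by move/eqP; rewrite ltn_eqF.
by rewrite untag_dflt// eq_sym.
Qed.

Lemma reduced_drop n y : reduced o y -> reduced o (drop n y).
Proof.
rewrite -{1}(cat_take_drop n y) /reduced all_cat => /andP[/andP[_ ->]].
by move/cat_sorted2 => [].
Qed.

Lemma reduced_take n y : reduced o y -> reduced o (take n y).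
Proof.
rewrite -{1}(cat_take_drop n y) /reduced all_cat => /andP[/andP[-> _]].
by move/cat_sorted2 => [].
Qed.

Lemma reduced_wstem i y : reduced o y -> reduced o (wstem o i y).
Proof. by rewrite /wstem; case: ifP => // _; apply: reduced_take. Qed.

Lemma reduced_wext x i (v : V i) : reduced o x -> wtype x != Some i ->
  reduced o (wext o x v).
Proof.
rewrite /wext; case: (eqVneq v (o i)) => [_//|vo]; rewrite /reduced all_rcons /= vo.
case/lastP: x => // x a /andP[->] /= sx; rewrite wtype_rcons => ai.
rewrite -!cats1 -catA; move: sx; rewrite -cats1; case: x => [_|b x] /=.
  by rewrite andbT; apply: contra_neq ai => ->.
rewrite !cat_path /= andbT => /andP[-> ->] /=.
by rewrite andbT; apply: contra_neq ai => ->.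
Qed.

(** Recovers [w] from the word [xw] when [n] is the length of [x]; being total, it needs no proof
    that [x] is a prefix. *)
Definition wdrop n (y : freeprod o) : freeprod o :=
  exist _ (drop n (val y)) (reduced_drop n _ (valP y)).

Definition word_ext (x : freeprod o) i (v : V i)
    (xi : wtype (val x) != Some i) : freeprod o :=
  exist _ (wext o (val x) v) (reduced_wext _ _ v (valP x) xi).

Definition letter_word i (v : V i) : freeprod o := word_ext eword i v isT.

Lemma wtype_letter_word i (v : V i) j : j != i ->
  wtype (val (letter_word i v)) != Some j.
Proof.
move=> ji; rewrite /= /wext; case: (v =P o i) => // _; rewrite wtype_rcons /=.
by apply: contra_neq ji => -[->].
Qed.

Lemma letter_word_eword i (v : V i) : v != o i -> letter_word i v != eword.
Proof.
by move=> vo; rewrite -(inj_eq val_inj) /= /wext (negbTE vo).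
Qed.

Lemma wdrop_word_ext (x : freeprod o) i (v : V i)
    (xi : wtype (val x) != Some i) :
  wdrop (size (val x)) (word_ext x i v xi) = letter_word i v.
Proof.
apply: val_inj => /=; rewrite /wext; case: (v =P o i) => _; rewrite ?drop_size//.
by rewrite -cats1 drop_size_cat.
Qed.

Lemma prefix_word_ext (x : freeprod o) i (v : V i)
    (xi : wtype (val x) != Some i) : prefix (val x) (val (word_ext x i v xi)).
Proof.
by rewrite /= /wext; case: (v =P o i) => _; rewrite ?prefix_refl ?prefix_rcons.
Qed.

End Words.

Arguments word_ext {r V o} x {i} v xi.
Arguments letter_word {r V o i} v.

(** * The free product kernel and its cones *)

Section FreeKernel.
Context {R : realType} {r : nat} {V : 'I_r -> countType} (o : forall i, V i).
Context (p : forall i, V i -> V i -> R) (alpha : 'I_r -> R).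
Context (p_stoch : forall i, stochastic (p i)).
Context (alpha_gt0 : forall i, (0 < alpha i)%R).
Context (alpha_sum : (\sum_(i < r) alpha i = 1)%R).
Implicit Types (i j : 'I_r) (x y z : freeprod o) (f : freeprod o -> \bar R).

Local Notation q := (freeprod_kernel o p alpha).

Lemma pbar_ge0 i (y z : seq (letter V)) : (0 <= pbar o p i y z)%R.
Proof. by rewrite /pbar; case: ifP => // _; case: (p_stoch i). Qed.

Lemma freeprod_kernel_ge0 : nonneg_kernel q.
Proof.
by move=> x y; apply: sumr_ge0 => i _; rewrite mulr_ge0 ?pbar_ge0// ltW.
Qed.

Lemma pbar_le_freeprod_kernel i x y :
  (alpha i * pbar o p i (val x) (val y) <= q x y)%R.
Proof.
rewrite /freeprod_kernel (bigD1 i)//= lerDl; apply: sumr_ge0 => j _.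
by rewrite mulr_ge0 ?pbar_ge0// ltW.
Qed.

(** The words reachable from [y] in the copy of [V i] share its stem and are indexed by their
    coordinate, so the sum is a row of [p i]. *)
Lemma esum_pbar i y : \esum_(z in [set: freeprod o])
  (pbar o p i (val y) (val z))%:E = 1.
Proof.
have [_ /(_ (wcoord o i (val y))) <-] := p_stoch i.
have ty := wtype_wstem i (valP y).
pose s : freeprod o := exist (fun w => reduced o w) _ (reduced_wstem o i _ (valP y)).
transitivity (\esum_(z in [set z : freeprod o | wstem o i (val z) = val s])
    (p i (wcoord o i (val y)) (wcoord o i (val z)))%:E); last first.
  rewrite (@reindex_esum _ _ _ [set: V i] _ (fun v => word_ext s v ty)).
    by apply: eq_esum => v _; rewrite /= wcoordK.
  split.
  - by move=> v _ /=; rewrite wstemK.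
  - move=> v v' _ _ /(congr1 val) /= /(congr1 (wcoord o i)).
    by rewrite !wcoordK.
  - move=> z zs; exists (wcoord o i (val z)) => //.
    by apply: val_inj; rewrite /= -[RHS](wextK i (valP z)) zs.
rewrite [RHS]esum_mkcond; apply: eq_esum => z _; rewrite /pbar.
case: eqVneq => [e|e]; first by rewrite mem_set.
by rewrite memNset//= => e'; rewrite e' eqxx in e.
Qed.

Lemma kop_freeprod_kernel1 x : kop q (fun=> 1) x = 1.
Proof.
have a0 i : (0 <= alpha i)%R by exact: ltW.
rewrite /kop.
transitivity (\esum_(z in [set: freeprod o])
    \sum_(i < r) ((alpha i)%:E * (pbar o p i (val x) (val z))%:E)).
  by apply: eq_esum => z _; rewrite mule1 -sumEFin.
rewrite esum_sum => [|z i _ _]; last by rewrite mule_ge0 ?lee_fin ?pbar_ge0.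
rewrite -[RHS]/(1%R%:E) -alpha_sum -sumEFin; apply: eq_bigr => i _.
rewrite esumZl ?lee_fin ?esum_pbar ?mule1// => z _.
by rewrite lee_fin pbar_ge0.
Qed.

Lemma freeprod_kernel_substochastic : substochastic q.
Proof. by move=> x; rewrite kop_freeprod_kernel1. Qed.

Lemma pbar_prefix i (x w y : seq (letter V)) : w != [::] ->
  pbar o p i (x ++ w) y != 0%R -> prefix x y.
Proof.
move=> w0; rewrite /pbar wstem_cat//; case: ifPn => [/eqP e _|_]; last by rewrite eqxx.
by apply: prefix_trans (prefix_wstem o i y); rewrite -e prefix_prefix.
Qed.

(** Equality can fail only for empty [w']: if [x] ends in a letter of type [i], its stem is shorter
    than [x] and the left side vanishes. *)
Lemma pbar_cat_le i (x w w' : seq (letter V)) : w != [::] ->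
  (pbar o p i (x ++ w) (x ++ w') <= pbar o p i w w')%R.
Proof.
move=> w0; have [->|w'0] := eqVneq w' [::]; last first.
  by rewrite /pbar !wstem_cat// !wcoord_cat// eqseq_cat// eqxx.
rewrite cats0 {1}/pbar wstem_cat// wcoord_cat//.
case: eqVneq => [e|_]; last exact: pbar_ge0.
have xs : prefix (x ++ wstem o i w) x by rewrite e prefix_wstem.
have /size0nil s0 : size (wstem o i w) = 0%N.
  have := size_prefix xs.
  by rewrite size_cat -{2}[size x]addn0 leq_add2l leqn0 => /eqP.
rewrite s0 cats0 in e; rewrite (wcoord_wstem_id _ _ x)//.
have n0 : wstem o i [::] = [::] by rewrite /wstem; case: ifP.
by rewrite /pbar s0 n0 eqxx (wcoord_wstem_id _ _ _ n0).
Qed.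

(** A step changes at most the last letter, so from a proper extension of [x] the prefix [x]
    survives and can be deleted on both sides. *)
Lemma freeprod_kernel_cone x y z : prefix (val x) (val y) -> y != x ->
  (q y z <= if prefix (val x) (val z)
    then q (wdrop o (size (val x)) y) (wdrop o (size (val x)) z) else 0)%R.
Proof.
move=> /prefixP[w yE] yx; have w0 : w != [::].
  by apply: contra_neq yx => w0; apply: val_inj; rewrite yE w0 cats0.
case: ifPn => [/prefixP[w' zE]|xz].
  apply: ler_sum => i _; rewrite ler_wpM2l//; first exact: ltW.
  by rewrite /= yE zE !drop_size_cat// pbar_cat_le.
rewrite le_eqVlt; apply/orP; left; apply/eqP; apply: big1 => i _.
apply/eqP; rewrite mulf_eq0; apply/orP; right; apply: contraNT xz.
by rewrite yE; apply: pbar_prefix.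
Qed.

Definition cone x f y : \bar R :=
  if prefix (val x) (val y) then f (wdrop o (size (val x)) y) else 1.

Lemma cone_itv x f y : (forall w, 0 <= f w <= 1) -> 0 <= cone x f y <= 1.
Proof. by move=> f01; rewrite /cone; case: ifP => // _; rewrite lexx lee01. Qed.

Lemma cone_refl x f : cone x f x = f eword.
Proof.
rewrite /cone prefix_refl; congr f; apply: val_inj => /=.
exact: drop_size.
Qed.

(** Off the cone the value is the maximum 1. Inside, away from the apex, deleting [x] reduces the
    claim to superharmonicity of [f] at a nonempty word. *)
Lemma cone_superharmonic x f : (forall w, 0 <= f w <= 1) ->
  (forall w, w != eword -> kop q f w <= f w) ->
  forall y, y != x -> kop q (cone x f) y <= cone x f y.
Proof.
move=> f01 fP y yx; rewrite {2}/cone; case: ifPn => [xy|_]; last first.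
  apply: le_trans (freeprod_kernel_substochastic y).
  apply: le_kop; first exact: freeprod_kernel_ge0.
  by move=> w; case/andP: (cone_itv x f w f01).
set d := wdrop o (size (val x)).
have q0 := freeprod_kernel_ge0; have f0 w : 0 <= f w by case/andP: (f01 w).
have dy : d y != eword.
  apply: contra_neq yx => /(congr1 val) /=; have /prefixP[w yE] := xy.
  rewrite yE drop_size_cat// => w0; apply: val_inj.
  by rewrite yE w0 cats0.
apply: le_trans (fP _ dy).
pose C := [set z : freeprod o | prefix (val x) (val z)].
apply: (@le_trans _ _ (\esum_(z in C) ((q (d y) (d z))%:E * f (d z)))).
  rewrite [leRHS]esum_mkcond; apply: le_esum => z _.
  have := freeprod_kernel_cone x y z xy yx.
  rewrite [z \in C](_ : _ = prefix (val x) (val z)).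
    rewrite /cone; case: ifP => xz le; first by rewrite lee_wpmul2r ?lee_fin.
    by rewrite mule1 lee_fin.
  by apply/idP/idP => [/set_mem|xz]; rewrite ?inE.
(* Deleting the prefix is injective on the cone, so the sum is a part of the one over all words. *)
rewrite -(@esum_image _ _ _ C d (fun w => (q (d y) w)%:E * f w)).
  rewrite esum_mkcond; apply: le_esum => w _.
  by case: ifP => // _; rewrite mule_ge0 ?lee_fin.
move=> z z' /set_mem/prefixP[w zE] /set_mem/prefixP[w' zE'] /(congr1 val) /=.
rewrite zE zE' !drop_size_cat// => ww; apply: val_inj.
by rewrite zE zE' ww.
Qed.

(** The gap comes from the single step from [x] to [xv] and does not depend on [x]. *)
Lemma cone_escape x f j (v : V j) (c : R) : (forall w, 0 <= f w <= 1) ->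
  wtype (val x) != Some j -> f (letter_word v) <= c%:E -> (c <= 1)%R ->
  kop q (cone x f) x <= (1 - alpha j * p j (o j) v * (1 - c))%:E.
Proof.
move=> f01 xj fc c1.
have q0 := freeprod_kernel_ge0; have qs := freeprod_kernel_substochastic.
apply: le_trans (kop_le_gap q q0 (cone x f) x (word_ext x v xj) c qs _ _) _.
- by move=> w; apply: cone_itv.
- by rewrite /cone prefix_word_ext wdrop_word_ext.
rewrite lee_fin lerD2l lerN2 ler_wpM2r ?subr_ge0//.
apply: le_trans (pbar_le_freeprod_kernel j _ _).
(* Reading [x] as [x] followed by the root of [V j] exhibits the step as one of [p j]. *)
have {1}-> : val x = wext o (val x) (o j) by rewrite /wext eqxx.
by rewrite /= pbar_wext.
Qed.

End FreeKernel.

(** * Uniform bound on the diagonal of the Green function *)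

Lemma green_fin_num (R : realType) (T : countType) (q : T -> T -> R) x y :
  nonneg_kernel q -> 1 < green_radius q -> green q x y \is a fin_num.
Proof.
move=> q0 rad.
have : 1 < conv_radius (fun n => nstep q n x y).
  by apply: lt_le_trans rad _; apply: ereal_inf_lbound; exists (x, y).
(* The series converges at some [z > 1] and dominates termwise the series at 1. *)
move=> /ereal_sup_gt[_ [z [z0 zfin] <-]]; rewrite lte_fin => z1.
rewrite ge0_fin_numE ?green_ge0//; apply: le_lt_trans zfin.
apply: lee_nneseries => n _; first by rewrite nstep_ge0.
by rewrite lee_pemulr ?nstep_ge0 ?lee_fin ?exprn_ege1// ltW.
Qed.

Lemma finite_pos_lower_bound (R : realType) (r : nat) (e : 'I_r -> R) :
  (forall i, (0 < e i)%R) -> exists2 d : R, (0 < d)%R & forall i, (d <= e i)%R.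
Proof.
(* The initial value 1 keeps the minimum positive even for an empty family. *)
move=> e0; exists (\big[Order.min/1%R]_i e i) => [|i].
  by elim/big_ind: _ => // a b a0 b0; rewrite lt_min a0 b0.
exact: bigmin_le_cond.
Qed.

Section Bound.
Context {R : realType} {r : nat} {V : 'I_r -> countType} (o : forall i, V i).
Context (p : forall i, V i -> V i -> R) (alpha : 'I_r -> R).
Context (p_stoch : forall i, stochastic (p i)).
Context (p_root : forall i, p i (o i) (o i) = 0%R).
Context (alpha_gt0 : forall i, (0 < alpha i)%R).
Context (alpha_sum : (\sum_(i < r) alpha i = 1)%R).
Context (r_ge2 : (2 <= r)%N).

Local Notation q := (freeprod_kernel o p alpha).
Local Notation G := (green q).
Local Notation F u y := (green (stopped q y) u y).

Context (Gfin : forall x, G x x \is a fin_num).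

Let q0 : nonneg_kernel q := freeprod_kernel_ge0 o p alpha p_stoch alpha_gt0.

Let qs : substochastic q :=
  freeprod_kernel_substochastic o p alpha p_stoch alpha_gt0 alpha_sum.

Let f (w : freeprod o) := F w eword.

Let f01 w : 0 <= f w <= 1.
Proof. by rewrite hit_ge0// hit_le1. Qed.

Let fP w : w != eword -> kop q f w <= f w.
Proof. by move=> w0; rewrite [leRHS]hit_step. Qed.

Let ffin w : f w < 1 -> exists c : R, f w = c%:E /\ (c < 1)%R.
Proof.
have /andP[] := f01 w; case: (f w) => [c| |]// _ _ c1.
by exists c; rewrite -lte_fin.
Qed.

Let other i : exists j : 'I_r, j != i.
Proof.
have h0 : (0 < r)%N by exact: ltnW.
have [i0|i0] := eqVneq (val i) 0%N; last first.
  by exists (Ordinal h0); apply: contra_neq i0 => <-.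
by exists (Ordinal r_ge2); apply/eqP => e; rewrite -e in i0.
Qed.

(** Otherwise the return probability to the empty word is at least 1, and [green_return] gives
    [1 + g <= g] for a finite [g]. *)
Lemma hit_eword_lt1 : exists i (v : V i),
  (0 < p i (o i) v)%R /\ F (letter_word v) eword < 1.
Proof.
apply: contrapT => no.
have f1 i (v : V i) : (0 < p i (o i) v)%R -> 1 <= f (letter_word v).
  by move=> pv; rewrite leNgt; apply/negP => fv; apply: no; exists i, v.
have U1 : 1 <= kop q f eword.
  rewrite -[leLHS](kop_freeprod_kernel1 o p alpha p_stoch alpha_gt0 alpha_sum eword).
  apply: le_esum => w _; have [qw|qw] := eqVneq (q eword w) 0%R.
    by rewrite qw !mul0e.
  apply: lee_wpmul2l; first by rewrite lee_fin.
  have [i pi] : exists i, (alpha i * pbar o p i [::] (val w) != 0)%R.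
    apply: contrapT => nex; case/eqP: qw; apply: big1 => i _.
    by apply/eqP/negPn/negP => ne; apply: nex; exists i.
  move: pi; rewrite mulf_eq0 negb_or => /andP[_].
  rewrite /pbar [wstem o i [::]](_ : _ = [::]); last by rewrite /wstem; case: ifP.
  case: ifPn => [/eqP e|_]; last by rewrite eqxx.
  rewrite [wcoord o i [::]](_ : _ = o i); last first.
    by apply: wcoord_wstem_id; rewrite /wstem; case: ifP.
  (* The stem of [w] is empty, so [w] is the word of its coordinate. *)
  move=> pn0; rewrite [w](_ : _ = letter_word (wcoord o i (val w))).
    apply: f1; rewrite lt_neqAle eq_sym pn0 /=.
    by case: (p_stoch i) => + _; apply.
  by apply: val_inj => /=; rewrite {1}e wextK//; apply: valP.
have := green_return q q0 _ (Gfin eword).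
have := green_ge1 q q0 (eword : freeprod o); have := Gfin eword.
case: (G eword eword) => [g| |]// _; rewrite lee_fin => g1 gE.
have : (1 + g)%:E <= g%:E.
  rewrite [leRHS]gE EFinD leeD2l// lee_pemull// ?lee_fin//.
  exact: le_trans g1.
by rewrite lee_fin; lra.
Qed.

(** For [k] other than [j], the walk at a letter [u] of [V k] may step to [uv] and then fail to come
    back to [u], hence to the empty word. *)
Lemma hit_eword_lt1_all k : exists v : V k,
  (0 < p k (o k) v)%R /\ F (letter_word v) eword < 1.
Proof.
have [j [v [pv fv]]] := hit_eword_lt1.
have [kj|kj] := eqVneq k j; first by rewrite kj; exists v.
have [u pu] : exists u : V k, (0 < p k (o k) u)%R.
  apply: contrapT => no; have [p0 /(_ (o k))] := p_stoch k.
  rewrite esum1 => [|u _]; first by move=> /eqP; rewrite eqe eq_sym oner_eq0.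
  congr (_%:E); apply/eqP; rewrite eq_le p0 andbT leNgt; apply/negP => pu.
  by apply: no; exists u.
exists u; split=> //.
have uo : u != o k by apply: contraTneq pu => ->; rewrite p_root ltxx.
pose x := letter_word u : freeprod o.
have xj : wtype (val x) != Some j by rewrite wtype_letter_word// eq_sym.
have f1 : f eword = 1 by exact: hit_refl.
have [c [fc c1]] := ffin _ fv.
have K : kop q (cone o x f) x <= (1 - alpha j * p j (o j) v * (1 - c))%:E.
  by apply: cone_escape => //; rewrite ?fc// ltW.
have K1 : kop q (cone o x f) x < 1.
  by apply: le_lt_trans K _; rewrite lte_fin ltrBlDr ltrDl !mulr_gt0// subr_gt0.
have c01 w : 0 <= cone o x f w <= 1 by exact: cone_itv.
have c0 w : 0 <= cone o x f w by case/andP: (c01 w).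
(* The cone function equals 1 at [x]. Replacing this value by its one-step average, which is below
   1, only lowers the function and makes it superharmonic at [x] too. *)
pose g w := if w == x then kop q (cone o x f) x else cone o x f w.
have gle w : g w <= cone o x f w.
  rewrite /g; case: eqVneq => // ->; rewrite cone_refl f1; exact: ltW.
suff : F x eword <= g x by rewrite /g eqxx => /le_lt_trans; apply.
apply: hit_min => // [w||w w0].
- by rewrite /g; case: ifP => // _; apply: kop_ge0.
(* The empty word lies off the cone of [x], where the value is 1. *)
- rewrite /g eq_sym (negbTE (letter_word_eword _ _ _ uo)) /cone.
  by rewrite /x /= /wext (negbTE uo).
- apply: (@le_trans _ _ (kop q (cone o x f) w)); first exact: le_kop.
  rewrite /g; case: eqVneq => [->//|wx].
  exact: cone_superharmonic.
Qed.

(** The cone function dominates the probability of hitting [x], and [cone_escape] gives the same gap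
    for all such [x]. *)
Lemma return_prob_gap k : exists e : R, (0 < e)%R /\
  forall x : freeprod o, wtype (val x) != Some k ->
    kop q (fun w => F w x) x <= (1 - e)%:E.
Proof.
have [v [pv fv]] := hit_eword_lt1_all k.
have [c [fc c1]] := ffin _ fv.
exists (alpha k * p k (o k) v * (1 - c))%R; split.
  by rewrite !mulr_gt0// subr_gt0.
move=> x xk; apply: le_trans (_ : kop q (cone o x f) x <= _); last first.
  by apply: cone_escape => //; rewrite ?fc// ltW.
apply: le_kop => //; apply: hit_min => // [w||w wx].
- by case/andP: (cone_itv o x f w f01).
- by rewrite cone_refl [leRHS]hit_refl.
- exact: cone_superharmonic.
Qed.

(** As [r >= 2], each word avoids some type as its own; the least of the finitely many gaps then
    works for all words. *)
Lemma green_diag_bounded : exists M : R, forall x, G x x <= M%:E.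
Proof.
have [e eP] := choice return_prob_gap.
have [d d0 dP] := finite_pos_lower_bound _ _ e (fun i => (eP i).1).
exists (d^-1)%R => x; have [j xj] : exists j, wtype (val x) != Some j.
  case: (wtype (val x)) => [i|]; last by exists (Ordinal r_ge2).
  by have [j ji] := other i; exists j; rewrite eq_sym; apply: contra_neq ji => -[].
apply: green_le_inv => //; apply: le_trans ((eP j).2 x xj) _.
by rewrite lee_fin lerD2l lerN2.
Qed.

End Bound.

(** * From bounded comparison to equal rates of escape *)

Lemma lne_le_mul (R : realType) (a b : \bar R) (M : R) : 0 <= a -> 0 <= b ->
  (0 < M)%R -> a <= b * M%:E -> lne a <= lne b + (ln M)%:E.
Proof.
move=> a0 b0 M0; have [->|bn0] := eqVneq b 0.
  by rewrite mul0e => /le0_lneNy ->; exact: leNye.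
have bp : 0 < b by rewrite lt0e bn0.
move=> ab; rewrite -lne_EFin// -lneM ?in_itv/= ?leey ?lte_fin ?bp ?M0//.
by rewrite lee_lne// in_itv/= ?a0 ?leey// mule_ge0// lee_fin ltW.
Qed.

Lemma cvg_mul_invn_bounded_dist (R : realType) (a b : nat -> \bar R)
    (c ell : R) :
  (forall n, a n - c%:E <= b n <= a n + c%:E) ->
  a n * (n%:R^-1)%:E @[n --> \oo] --> ell%:E ->
  b n * (n%:R^-1)%:E @[n --> \oo] --> ell%:E.
Proof.
move=> ab acv.
have h (s : R) : (a n + s%:E) * (n%:R^-1)%:E @[n --> \oo] --> ell%:E.
  have -> : (fun n => (a n + s%:E) * (n%:R^-1)%:E) =
      (fun n => a n * (n%:R^-1)%:E + (s * n%:R^-1)%:E).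
    by apply/funext => n; rewrite muleDl// fin_num_adde_defl.
  rewrite -[ell%:E]adde0; apply: cvgeD => //.
  apply: cvg_EFin; first by near=> n.
  rewrite -(mulr0 s); apply: cvgMr.
  (* The harmonic sequence has terms [1 / (n + 1)], hence the shift. *)
  by rewrite -cvg_shiftS; exact: cvg_harmonic.
apply: (squeeze_cvge _ (h (- c)%R) (h c)); apply: nearW => n.
by have /andP[l u] := ab n; rewrite !lee_wpmul2r ?lee_fin ?invr_ge0.
Unshelve. all: by end_near. Qed.

Lemma ae_exists (R : realType) (d : measure_display) (Omega : measurableType d)
    (Pr : probability Omega R) (P : Omega -> Prop) :
  {ae Pr, forall x, P x} -> exists x, P x.
Proof.
move=> aeP; apply: contrapT => /forallNP no.
have [A [mA A0 sub]] := aeP.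
have AT : A = setT by apply/seteqP; split=> // x _; apply: sub; apply: no.
by move/eqP: A0; rewrite AT probability_setT onee_eq0.
Qed.

Theorem corollary3p3 (R : realType) (r : nat) (V : 'I_r -> countType)
    (o : forall i, V i) (p : forall i, V i -> V i -> R) (alpha : 'I_r -> R)
    (d : measure_display) (Omega : measurableType d)
    (Pr : probability Omega R) (X : nat -> Omega -> freeprod o) (ell : R) :
  (2 <= r)%N ->
  ~ (r = 2%N /\ forall i, ([set: V i] #= `I_2)%card) ->
  (forall i, stochastic (p i)) ->
  (forall i (x : V i), exists n : nat, 0 < nstep (p i) n (o i) x) ->
  (forall i (x : V i), p i x x = 0%R) ->
  (forall i, uniformly_irreducible (p i)) ->
  (forall i, (0 < alpha i)%R) ->
  (\sum_(i < r) alpha i = 1)%R ->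
  1 < green_radius (freeprod_kernel o p alpha) ->
  markov_chain Pr (freeprod_kernel o p alpha) eword X ->
  {ae Pr, forall omega,
    length_fun (freeprod_kernel o p alpha) eword (X n omega) * (n%:R^-1)%:E
      @[n --> \oo] --> ell%:E} ->
  (0 <= ell)%R /\
  {ae Pr, forall omega,
    dGreen (freeprod_kernel o p alpha) eword (X n omega) * (n%:R^-1)%:E
      @[n --> \oo] --> ell%:E}.
Proof.
move=> r2 _ ps _ p0 _ a0 a1 rad _ aeL.
set q := freeprod_kernel o p alpha.
have q0 : nonneg_kernel q by exact: freeprod_kernel_ge0.
have qs : substochastic q by exact: freeprod_kernel_substochastic.
have Gfin x y : green q x y \is a fin_num by exact: green_fin_num.
have [M GM] := green_diag_bounded o p alpha ps (fun i => p0 i (o i)) a0 a1 r2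
  (fun x => Gfin x x).
have M0 : (0 < M)%R.
  rewrite -lte_fin; apply: lt_le_trans (GM eword).
  by apply: lt_le_trans (green_ge1 q q0 _).
(* Logarithms turn the factor [M] into the additive error [ln M], uniform in [x]. *)
have bnd x : length_fun q eword x - (ln M)%:E <= dGreen q eword x
    <= length_fun q eword x + (ln M)%:E.
  have [FL LF] := hit_taboo_equiv q q0 eword x M (GM _) (GM _) (Gfin _ _).
  have F0 : 0 <= Fgen q eword x 1 by rewrite Fgen_green// hit_ge0.
  have L0 : 0 <= Lgen q eword x 1.
    by rewrite Lgen_green// green_ge0//; apply: taboo_ge0.
  rewrite -Fgen_green// -Lgen_green// in FL LF.
  rewrite /length_fun /dGreen; apply/andP; split.
    by rewrite -fin_num_oppeD// leeN2 lne_le_mul.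
  by rewrite leeNl fin_num_oppeD// oppeK leeBlDr// lne_le_mul.
have aeF : {ae Pr, forall omega,
    dGreen q eword (X n omega) * (n%:R^-1)%:E @[n --> \oo] --> ell%:E}.
  apply: filterS aeL => omega; apply: cvg_mul_invn_bounded_dist => n.
  exact: bnd.
(* The sign of the constant [ell] can be read off a single convergent trajectory, along which
   [dGreen] is nonnegative because [F <= 1]. *)
split=> //; have [omega cv] := ae_exists _ _ _ _ _ aeF.
rewrite -lee_fin -(cvg_lim _ cv)//; apply: lime_ge.
  by apply/cvg_ex; exists ell%:E.
apply: nearW => n; rewrite mule_ge0 ?lee_fin ?invr_ge0//.
by rewrite /dGreen oppe_ge0 lne_le0 Fgen_green// hit_le1.
Qed.
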